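(* Let $q$ be a fixed prime power and $k\ge 2$ a fixed integer. Let $\mathfrak t=(t_1,\dots,t_k)$ be a fixed $k$-tuple of nonnegative integers, and let $\mathfrak m=(m_1,\dots,m_k)$, $\mathfrak n=(n_1,\dots,n_k)$ be $k$-tuples of nonnegative integers such that $\mathfrak t\le\mathfrak m$, $\mathfrak t\le\mathfrak n$, and $\max\{m_i,n_i\}>2t_i+1$ for all $1\le i\le k$. Then $$P_k(\mathfrak m;\mathfrak n)=\sum_{\mathfrak 0\le\mathfrak d\le\mathfrak t}N_k(\mathfrak m-\mathfrak d)N_k(\mathfrak n-\mathfrak d)A_k(\mathfrak d)+O\Bigl(q^{\max_{1\le j\le k}\bigl(\frac{m_j-t_j}{m_j+1}\prod_{i=1}^k(m_i+1)+\frac{n_j-t_j}{n_j+1}\prod_{i=1}^k(n_i+1)\bigr)}\Bigr),$$ where the constant in the $O$-term is independent of $\mathfrak m$ and $\mathfrak n$ (it may depend on $q,k,\mathfrak t$).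
   Context: $\mathbb F_q$ is the finite field with $q$ elements. Two polynomials in $\mathbb F_q[x_1,\dots,x_k]$ are identified if they differ by a factor in $\mathbb F_q^\times$; the classes are called normalized polynomials. The vector degree of a nonzero $f$ is $\operatorname{Deg} f=(\deg_{x_1}f,\dots,\deg_{x_k}f)$. $k$-tuples of nonnegative integers are ordered componentwise, $\mathfrak 0$ is the zero tuple, and $\mathfrak a<\mathfrak b$ means $\mathfrak a\le\mathfrak b$ and $\mathfrak a\ne\mathfrak b$. $\mathcal N_k(\mathfrak m)$ is the set of normalized polynomials $f\in\mathbb F_q[x_1,\dots,x_k]$ with $\operatorname{Deg} f=\mathfrak m$, $N_k(\mathfrak m)=|\mathcal N_k(\mathfrak m)|$, and $I_k(\mathfrak m)$ is the number of irreducible elements of $\mathcal N_k(\mathfrak m)$. $P_k(\mathfrak m;\mathfrak n)=|\{(f,g)\in\mathcal N_k(\mathfrak m)\times\mathcal N_k(\mathfrak n):\gcd(f,g)=1\}|$. Finally $$A_k(\mathfrak d)=\sum_{h\in\mathcal N_k(\mathfrak d)}\mu(h)=\sum_{(a_{\mathfrak i})}(-1)^{\sum_{\mathfrak i}a_{\mathfrak i}}\prod_{\mathfrak 0<\mathfrak i\le\mathfrak d}\binom{I_k(\mathfrak i)}{a_{\mathfrak i}},$$ where the last sum is over families $(a_{\mathfrak i})_{\mathfrak 0<\mathfrak i\le\mathfrak d}$ of nonnegative integers with $\sum_{\mathfrak i}a_{\mathfrak i}\mathfrak i=\mathfrak d$, and $\mu(h)=(-1)^s$ if $h$ is a product of $s$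 distinct irreducible normalized polynomials, $\mu(h)=0$ if $h$ is divisible by the square of an irreducible. *)

(* Defs.v *)
From HB Require Import structures.
From mathcomp Require Import all_boot all_order all_algebra.
From mathcomp Require Import finmap boolp mpoly.

Set Implicit Arguments.
Unset Strict Implicit.
Unset Printing Implicit Defensive.

Import GRing.Theory.
Local Open Scope ring_scope.

(* [Deg 0] is the zero tuple here, so nonvanishing is always required separately. *)
Definition Deg (F : fieldType) (k : nat) (f : {mpoly F[k]}) : 'X_{1..k} :=
  [multinom \max_(m <- msupp f) m i | i < k].

Definition mpdivides (F : fieldType) (k : nat) (d f : {mpoly F[k]}) : Prop :=
  exists g, f = g * d.

(* 1 is a greatest common divisor of f and g. *)
Definition mpcoprime (F : fieldType) (k : nat) (f g : {mpoly F[k]}) : Prop :=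
  forall d, mpdivides d f -> mpdivides d g -> mpdivides d 1.

Definition mpirreducible (F : fieldType) (k : nat) (f : {mpoly F[k]}) : Prop :=
  [/\ f != 0, f \isn't a GRing.unit &
      forall g h, f = g * h -> g \is a GRing.unit \/ h \is a GRing.unit].

Definition assoc (F : finFieldType) (k : nat) : rel {mpoly F[k]} :=
  fun f g => [exists c : F, (c != 0) && (f == c *: g)].

Lemma assoc_refl (F : finFieldType) (k : nat) : reflexive (@assoc F k).
Proof. by move=> f; apply/existsP; exists 1; rewrite oner_eq0 scale1r eqxx. Qed.

Lemma assoc_sym (F : finFieldType) (k : nat) : ssrbool.symmetric (@assoc F k).
Proof.
suff H f g : assoc f g -> @assoc F k g f by move=> f g; apply/idP/idP; apply: H.
case/existsP=> c /andP[c0 /eqP->]; apply/existsP; exists c^-1.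
by rewrite invr_eq0 c0 scalerA mulVf // scale1r eqxx.
Qed.

Lemma assoc_trans (F : finFieldType) (k : nat) : transitive (@assoc F k).
Proof.
move=> g f h /existsP[c /andP[c0 /eqP->]] /existsP[d /andP[d0 /eqP->]].
by apply/existsP; exists (c * d); rewrite mulf_neq0 // scalerA eqxx.
Qed.

Canonical assoc_equiv (F : finFieldType) (k : nat) :=
  EquivRel (@assoc F k) (@assoc_refl F k) (@assoc_sym F k) (@assoc_trans F k).

(* The class of 0 belongs to this type, but to none of the sets [normpolys m]. *)
Definition normpoly (F : finFieldType) (k : nat) := {eq_quot @assoc F k}%qT.
HB.instance Definition _ (F : finFieldType) (k : nat) :=
  Choice.on (normpoly F k).
HB.instance Definition _ (F : finFieldType) (k : nat) :=
  EqQuotient.on (normpoly F k).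

Definition npclass (F : finFieldType) (k : nat) (f : {mpoly F[k]}) :
  normpoly F k := (\pi_(normpoly F k) f)%qT.

Definition mpoly_of_coefs (F : finFieldType) (k b : nat)
    (c : {ffun 'X_{1..k < b} -> F}) : {mpoly F[k]} :=
  \sum_(i : 'X_{1..k < b}) c i *: 'X_[i].

(* A polynomial of vector degree m only involves monomials of total degree at
   most [mdeg m]; the finite type of such monomials serves to enumerate these
   polynomials, see [mem_polys] and [mem_normpolys]. *)
Definition polys (F : finFieldType) (k : nat) (m : 'X_{1..k}) :
    {fset {mpoly F[k]}} :=
  [fset f in [fset mpoly_of_coefs c
                | c in {ffun 'X_{1..k < (mdeg m).+1} -> F}]
   | (f != 0) && (Deg f == m)]%fset.

Definition normpolys (F : finFieldType) (k : nat) (m : 'X_{1..k}) :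
    {fset normpoly F k} :=
  [fset npclass f | f in polys F m]%fset.

Definition Nk (F : finFieldType) (k : nat) (m : 'X_{1..k}) : nat :=
  #|` normpolys F m|.

Definition Pk (F : finFieldType) (k : nat) (m n : 'X_{1..k}) : nat :=
  #|` [fset fg in (normpolys F m `*` normpolys F n)%fset
       | `[< mpcoprime (repr fg.1) (repr fg.2) >]]%fset|.

Definition distinct_irreducible_factorization (F : finFieldType) (k : nat)
    (h : normpoly F k) (S : {fset normpoly F k}) : Prop :=
  (forall p, p \in S -> mpirreducible (repr p)) /\
  h = npclass (\prod_(p <- S) repr p).

(* By unique factorization, S is determined by h when it exists, and a class of
   nonzero polynomials without such an S is divisible by the square of an
   irreducible. *)
Definition mu (F : finFieldType) (k : nat) (h : normpoly F k) : int :=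
  if pselect (exists S, distinct_irreducible_factorization h S) is left hS
  then (-1) ^+ #|` projT1 (cid hS)| else 0.

Definition Ak (F : finFieldType) (k : nat) (d : 'X_{1..k}) : int :=
  \sum_(h <- normpolys F d) mu h.

(* The nat divisions are exact, and t <= m, n makes the subtractions genuine. *)
Definition error_exponent (k : nat) (t m n : 'X_{1..k}) : nat :=
  (\max_(j < k)
     (((m j - t j) * \prod_(i < k) (m i).+1) %/ (m j).+1 +
      ((n j - t j) * \prod_(i < k) (n i).+1) %/ (n j).+1))%N.

Lemma npclassP (F : finFieldType) (k : nat) (f g : {mpoly F[k]}) :
  reflect (exists2 c : F, c != 0 & f = c *: g) (npclass f == npclass g).
Proof.
rewrite /npclass piE; apply: (iffP existsP) => [[c /andP[c0 /eqP->]]|[c c0 ->]];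
  by exists c; rewrite ?c0 ?eqxx.
Qed.

Lemma mem_polys (F : finFieldType) (k : nat) (m : 'X_{1..k}) (f : {mpoly F[k]}) :
  (f \in polys F m) = (f != 0) && (Deg f == m).
Proof.
rewrite !inE /=; apply/andP/idP => [[]//|fm]; split=> //.
apply/imfsetP; exists [ffun i : 'X_{1..k < (mdeg m).+1} => f@_i] => //=.
case/andP: fm => _ /eqP Dm.
have lef : (msize f <= (mdeg m).+1)%N.
  rewrite msizeE; apply/bigmax_leqP_seq => u uf _; rewrite ltnS !mdegE.
  by apply: leq_sum => i _; rewrite -Dm mnmE (bigD1_seq u) //= leq_maxl.
rewrite [LHS](mpolywE lef); apply: eq_bigr => i _.
by rewrite ffunE.
Qed.

Lemma DegZ (F : fieldType) (k : nat) (c : F) (f : {mpoly F[k]}) :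
  c != 0 -> Deg (c *: f) = Deg f.
Proof.
by move=> c0; apply/mnmP=> i; rewrite !mnmE; apply/perm_big/msuppZ.
Qed.

Lemma mem_normpolys (F : finFieldType) (k : nat) (m : 'X_{1..k})
    (f : {mpoly F[k]}) :
  (npclass f \in normpolys F m) = (f != 0) && (Deg f == m).
Proof.
apply/imfsetP/idP => /= [[g]|fm]; last by exists f; rewrite ?mem_polys.
rewrite mem_polys => gm /eqP /npclassP[c c0 ->].
by rewrite scaler_eq0 (negPf c0) DegZ.
Qed.

(* Main.v *)
From HB Require Import structures.
Require Import Defs.
From mathcomp Require Import all_boot all_order all_algebra.
From mathcomp Require Import finmap boolp mpoly zify ring lra.

(* By Moebius inversion, which rests on unique factorization in F[x_1, .., x_k]
   (Gauss), the main term counts every pair (f, g) with weight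
   sum mu(h), h ranging over the common divisors with Deg h <= t.  This weight
   is the indicator of coprimality as soon as all common divisors of f and g
   have degree <= t, and it is bounded by a constant otherwise.  The exceptional
   pairs have a common divisor h with d = Deg h and d_j > t_j for some j; for a
   given d there are at most q^phi(d) of them, where
     phi(d) = prod (d_i + 1) + prod (m_i - d_i + 1) + prod (n_i - d_i + 1),
   and phi(d) + sum d_i is at most the error exponent plus a constant, so that
   the sum over d is dominated by a geometric series. *)

Set Implicit Arguments.
Unset Strict Implicit.
Unset Printing Implicit Defensive.

Import Order.TTheory GRing.Theory Num.Theory.
Local Open Scope ring_scope.

(** * Unique factorization *)

Section Factorial.
Variable R : idomainType.
Implicit Types a b c p u : R.

Definition divides a b : Prop := exists c, b = c * a.

Definition prime_elt p : Prop :=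
  [/\ p != 0, p \isn't a GRing.unit &
      forall a b, divides p (a * b) -> divides p a \/ divides p b].

Definition prime_product a : Prop :=
  exists s u, [/\ u \is a GRing.unit, (forall p, p \in s -> prime_elt p) &
                  a = u * \prod_(p <- s) p].

Definition factorial_ring : Prop := forall a, a != 0 -> prime_product a.

Lemma divides_refl a : divides a a.
Proof. by exists 1; rewrite mul1r. Qed.

Lemma divides_mull a b c : divides a b -> divides a (c * b).
Proof. by case=> d ->; exists (c * d); rewrite mulrA. Qed.

Lemma divides_mulr a b c : divides a b -> divides a (b * c).
Proof. by rewrite mulrC; apply: divides_mull. Qed.

Lemma divides_trans b a c : divides a b -> divides b c -> divides a c.
Proof. by move=> ab [d ->]; apply: divides_mull. Qed.

Lemma dividesD a b c : divides a b -> divides a c -> divides a (b + c).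
Proof. by case=> d -> [e ->]; exists (d + e); rewrite mulrDl. Qed.

Lemma divides_unit p u : u \is a GRing.unit -> divides p u ->
  p \is a GRing.unit.
Proof. by move=> + [c def_u]; rewrite def_u unitrM => /andP[]. Qed.

Lemma prime_divides_prod p (I : eqType) (s : seq I) (E : I -> R) :
  prime_elt p -> divides p (\prod_(i <- s) E i) ->
  exists2 i, i \in s & divides p (E i).
Proof.
case=> p0 pU prp; elim: s => [|i s IHs].
  by rewrite big_nil => /(divides_unit (unitr1 R)); rewrite (negPf pU).
rewrite big_cons => /prp[|/IHs[j js pj]]; first by exists i; rewrite ?mem_head.
by exists j; rewrite // inE js orbT.
Qed.

Lemma prime_divides_assoc p q : prime_elt p -> prime_elt q -> divides p q ->
  exists2 u, u \is a GRing.unit & q = u * p.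
Proof.
move=> [p0 pU _] [q0 qU prq] [c def_q]; exists c => //.
have [|[d def_c]|[d def_p]] := prq c p; first by rewrite -def_q; apply: divides_refl.
  have /eqP : (d * p - 1) * q = 0 by rewrite mulrBl mulrAC -def_c -def_q mul1r subrr.
  rewrite mulf_eq0 (negPf q0) orbF subr_eq0 => /eqP dp1.
  by case/negP: pU; apply/unitrPr; exists d; rewrite mulrC.
have /eqP : (c * d - 1) * p = 0.
  by rewrite mulrBl mul1r mulrAC -def_q mulrC -def_p subrr.
rewrite mulf_eq0 (negPf p0) orbF subr_eq0 => /eqP cd1.
by apply/unitrPr; exists d.
Qed.

Lemma nonunit_prime_divisor a : factorial_ring -> a != 0 ->
  a \isn't a GRing.unit -> exists2 p, prime_elt p & divides p a.
Proof.
move=> factR /factR[[|p s] [u [uU prs ->]]]; first by rewrite big_nil mulr1 uU.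
move=> _; exists p; first by apply: prs; rewrite mem_head.
by rewrite big_cons mulrCA; apply/divides_mulr/divides_refl.
Qed.

Lemma prime_productM a b :
  prime_product a -> prime_product b -> prime_product (a * b).
Proof.
move=> [s [u [uU prs ->]]] [s' [u' [uU' prs' ->]]].
exists (s ++ s'), (u * u'); split; first by rewrite unitrM uU.
  by move=> p; rewrite mem_cat => /orP[/prs|/prs'].
by rewrite big_cat /= mulrACA.
Qed.

Lemma prime_product_prime p : prime_elt p -> prime_product p.
Proof.
exists [:: p], 1; split; rewrite ?unitr1 ?big_seq1 ?mul1r //.
by move=> q; rewrite inE => /eqP->.
Qed.

Lemma prime_product_unit u : u \is a GRing.unit -> prime_product u.
Proof. by exists [::], u; split; rewrite ?big_nil ?mulr1. Qed.

Lemma irreducible_prime p : factorial_ring ->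
    p != 0 -> p \isn't a GRing.unit ->
    (forall a b, p = a * b -> a \is a GRing.unit \/ b \is a GRing.unit) ->
  prime_elt p.
Proof.
move=> factR p0 pU irrp; have [[|q s] [u [uU prs def_p]]] := factR _ p0.
  by rewrite def_p big_nil mulr1 uU in pU.
have [q0 qU prq] : prime_elt q by apply: prs; rewrite mem_head.
rewrite big_cons mulrCA mulrC in def_p.
case: (irrp _ _ def_p) => [vU|]; last by rewrite (negPf qU).
set v := u * _ in def_p vU; split=> // a b.
have pq : divides q p by exists v.
have qp c : divides q c -> divides p c.
  by apply: divides_trans; exists v^-1; rewrite def_p mulKr.
by move=> /(divides_trans pq) /prq[] /qp; [left|right].
Qed.

End Factorial.

Section Gauss.
Variable R : idomainType.
Hypothesis factR : factorial_ring R.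
Implicit Types (p c : R) (f g h : {poly R}).

Lemma dividesCP p f : divides p%:P f <-> forall i, divides p f`_i.
Proof.
split=> [[g ->] i|]; first by exists g`_i; rewrite coefMC.
elim/poly_ind: f => [|f c IHf] pf; first by exists 0; rewrite mul0r.
have [i|g ->] := IHf; first by have := pf i.+1; rewrite coefD coefMX coefC addr0.
have := pf 0; rewrite coefD coefMX coefC add0r => -[d ->].
by exists (g * 'X + d%:P); rewrite mulrDl polyCM mulrAC.
Qed.

Lemma dividesC_mulX p f : divides p%:P (f * 'X) -> divides p%:P f.
Proof.
by move/dividesCP=> pf; apply/dividesCP=> i; have := pf i.+1; rewrite coefMX.
Qed.

Lemma prime_polyC p : prime_elt p -> prime_elt p%:P.
Proof.
case=> p0 pU prp; split; rewrite ?polyC_eq0 //.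
  by rewrite poly_unitE coefC eqxx (negPf pU) andbF.
have sub f g h : divides p%:P f -> divides p%:P (f + g) -> divides p%:P g.
  by case=> a -> [b def]; exists (b - a); rewrite mulrBl -def addrAC subrr add0r.
elim/poly_ind => [|f a IHf]; first by left; exists 0; rewrite mul0r.
elim/poly_ind => [|g b IHg] pfg; first by right; exists 0; rewrite mul0r.
have [|pa|pb] := prp a b.
- by have /dividesCP/(_ 0) := pfg; rewrite coef0M !coefD !coefMX !coefC !add0r.
- have pa' : divides p%:P a%:P by case: pa => d ->; exists d%:P; rewrite polyCM.
  have : divides p%:P (f * (g * 'X + b%:P) * 'X).
    apply: (@sub (a%:P * (g * 'X + b%:P))) => //; first exact: divides_mulr.
    by rewrite addrC mulrAC -mulrDl.
  case/dividesC_mulX/IHf => [pf|]; last by right.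
  by left; apply: dividesD => //; apply: divides_mulr.
- have pb' : divides p%:P b%:P by case: pb => d ->; exists d%:P; rewrite polyCM.
  have : divides p%:P ((f * 'X + a%:P) * g * 'X).
    apply: (@sub ((f * 'X + a%:P) * b%:P)) => //; first exact: divides_mull.
    by rewrite addrC -mulrA -mulrDr.
  case/dividesC_mulX/IHg => [|pg]; first by left.
  by right; apply: dividesD => //; apply: divides_mulr.
Qed.

Definition primitive f : Prop := forall p, prime_elt p -> ~ divides p%:P f.

Lemma primitive_cancelC f g c : primitive f -> c != 0 ->
  divides f (c%:P * g) -> divides f g.
Proof.
move=> primf /factR[s [u [uU prs ->]]]; rewrite polyCM -mulrA => -[k def].
have : divides f ((\prod_(p <- s) p)%:P * g).
  by exists (u^-1%:P * k); rewrite -mulrA -def !mulrA -polyCM mulVr ?mul1r.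
move: prs {k def}; elim: s g => [|p s IHs] g prs; first by rewrite big_nil mul1r.
rewrite big_cons polyCM -mulrA => -[k def].
have prp : prime_elt p by apply: prs; rewrite mem_head.
have [p0 _ prP] := prime_polyC prp.
have [|[k' def_k]|] := prP k f; last by move/(primf p prp).
  by rewrite -def; apply/divides_mulr/divides_refl.
apply: IHs; first by move=> q qs; apply: prs; rewrite inE qs orbT.
exists k'; apply: (mulfI p0); rewrite def def_k.
by rewrite -mulrA mulrCA.
Qed.

Lemma prod_prime_split (s : seq R) f q r : (forall p, p \in s -> prime_elt p) ->
    (\prod_(p <- s) p)%:P * f = q * r ->
  exists q' r' a b, [/\ f = q' * r', q = a%:P * q' & r = b%:P * r'].
Proof.
elim: s q r => [|p s IHs] q r prs.
  by rewrite big_nil mul1r => ->; exists q, r, 1, 1; rewrite !mul1r.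
have prp : prime_elt p by apply: prs; rewrite mem_head.
have {}prs p' : p' \in s -> prime_elt p'.
  by move=> sp'; apply: prs; rewrite inE sp' orbT.
have [p0 _ prP] := prime_polyC prp.
rewrite big_cons polyCM -mulrA => def.
have [|[k def_q]|[k def_r]] := prP q r.
- by rewrite -def; apply/divides_mulr/divides_refl.
- have /(IHs _ _ prs)[q' [r' [a [b [-> def_k ->]]]]] :
    (\prod_(p <- s) p)%:P * f = k * r.
    by apply: (mulfI p0); rewrite def def_q mulrCA mulrA.
  by exists q', r', (p * a), b; rewrite def_q def_k polyCM; split=> //; ring.
- have /(IHs _ _ prs)[q' [r' [a [b [-> -> def_k]]]]] :
    (\prod_(p <- s) p)%:P * f = q * k.
    by apply: (mulfI p0); rewrite def def_r mulrA mulrC.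
  by exists q', r', a, (p * b); rewrite def_r def_k polyCM; split=> //; ring.
Qed.

Lemma const_split c f q r : c != 0 -> c%:P * f = q * r ->
  exists q' r' a b, [/\ f = q' * r', q = a%:P * q' & r = b%:P * r'].
Proof.
case/factR=> s [u [uU prs ->]]; rewrite polyCM -mulrA => def.
have /(prod_prime_split prs)[q' [r' [a [b [-> def_q ->]]]]] :
    (\prod_(p <- s) p)%:P * f = (u^-1%:P * q) * r.
  by rewrite -mulrA -def !mulrA -polyCM mulVr ?mul1r.
exists q', r', (u * a), b; split=> //.
by rewrite polyCM -mulrA -def_q mulrA -polyCM mulrV ?mul1r.
Qed.

(* A nonzero element of minimal degree in the ideal (f, g) divides both f and g
   up to a constant, by pseudo-division; so it is constant or associated to f. *)
Lemma primitive_irreducible_prime f : primitive f -> (1 < size f)%N ->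
    (forall g h, f = g * h -> (size g <= 1)%N \/ (size h <= 1)%N) ->
  prime_elt f.
Proof.
move=> primf f1 irrf.
have f0 : f != 0 by rewrite -size_poly_gt0 ltnW.
split=> // [|g h fgh]; first by rewrite poly_unitE gtn_eqF.
pose inI r := exists a b, r = a * f + b * g.
have exI : exists n, `[< exists2 r, inI r & size r = n.+1 >].
  exists (size f).-1; apply/asboolP; exists f; last by rewrite prednK // ltnW.
  by exists 1, 0; rewrite mul1r mul0r addr0.
have [n /asboolP[r [a [b def_r]] rn] minr] := ex_minnP exI.
have r0 : r != 0 by rewrite -size_poly_gt0 rn.
have Ir v : inI v -> exists2 c, c != 0 & divides r (c%:P * v).
  case=> a' [b' def_v]; exists (lead_coef r ^+ scalp v r).
    by rewrite expf_neq0 // lead_coef_eq0.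
  have /eqP rem0 : v %% r == 0.
    apply: contraT => rem0; have : (n <= (size (v %% r)%R).-1)%N.
      apply: minr; apply/asboolP; exists (v %% r); last first.
        by rewrite prednK // size_poly_gt0.
      exists ((lead_coef r ^+ scalp v r)%:P * a' - v %/ r * a).
      exists ((lead_coef r ^+ scalp v r)%:P * b' - v %/ r * b).
      have /(congr1 (fun w => w - v %/ r * r)) := Pdiv.Idomain.divp_eq v r.
      rewrite [RHS]addrAC subrr add0r => <-.
      rewrite -mul_polyC def_v def_r; ring.
    by rewrite -ltnS -rn prednK ?size_poly_gt0 // leqNgt ltn_modp r0.
  exists (v %/ r); have := Pdiv.Idomain.divp_eq v r.
  by rewrite rem0 addr0 -mul_polyC.
have [|c c0 [q def_q]] := Ir f; first by exists 1, 0; rewrite mul1r mul0r addr0.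
have [|c' c'0 rg] := Ir g; first by exists 0, 1; rewrite mul1r mul0r add0r.
have [q' [r' [a1 [b1 [def_f _ def_r1]]]]] := const_split c0 def_q.
have b0 : b1 != 0 by apply: contraNneq r0 => b0; rewrite def_r1 b0 mul0r.
have [q1|r1] := irrf _ _ def_f.
  left; apply: (primitive_cancelC primf c'0); apply: divides_trans rg.
  have [e def_e] : exists e, q' = e%:P by exists q'`_0; apply/size1_polyC.
  have eU : e \is a GRing.unit.
    apply: contraT => eU; have [|p prp [d def_d]] := nonunit_prime_divisor factR _ eU.
      by apply: contraNneq f0 => e0; rewrite def_f def_e e0 mul0r.
    case: (primf p prp); exists (d%:P * r').
    by rewrite def_f def_e def_d polyCM mulrAC.
  exists (b1 * e^-1)%:P; rewrite def_r1 def_f def_e mulrA -polyCM.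
  by rewrite mulrVK.
right; have [e def_e] : exists e, r = e%:P.
  exists (b1 * r'`_0); rewrite def_r1 polyCM; congr (_ * _); exact/size1_polyC.
apply: (@primitive_cancelC f h e) => //.
  by rewrite def_e polyC_eq0 in r0.
rewrite -def_e def_r mulrDl; apply: dividesD.
  by apply/divides_mulr/divides_mull/divides_refl.
by rewrite -mulrA; apply: divides_mull.
Qed.

Lemma factorial_poly : factorial_ring {poly R}.
Proof.
move=> f; have [n] := ubnP (size f); elim: n f => // n IHn f sfn f0.
have /factR[s [u [uU prs def_l]]] : lead_coef f != 0 by rewrite lead_coef_eq0.
have [m] := ubnP (size s); elim: m => // m IHm in f s u sfn f0 uU prs def_l *.
rewrite ltnS => sm.
have [[p prp [f' def_f]]|primf] := pselect (exists2 p, prime_elt p & divides p%:P f).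
  have [p0 pU _] := prp.
  have f'0 : f' != 0 by apply: contraNneq f0 => f'0; rewrite def_f f'0 mul0r.
  rewrite def_f; apply: prime_productM; last exact/prime_product_prime/prime_polyC.
  have def_l' : lead_coef f' * p = u * \prod_(q <- s) q.
    by rewrite -def_l def_f lead_coefM lead_coefC.
  have [|q qs pq] := @prime_divides_prod _ p _ s id prp.
    exists (u^-1 * lead_coef f'); rewrite -mulrA def_l' mulrA mulVr ?mul1r //.
  have [v vU def_q] := prime_divides_assoc prp (prs q qs) pq.
  apply: (IHm f' (rem q s) (u * v)) => //.
  - by move: sfn; rewrite def_f mulrC size_Cmul.
  - by rewrite unitrM uU.
  - by move=> q' /mem_rem /prs.
  - apply: (mulIf p0); rewrite def_l' (perm_big _ (perm_to_rem qs)) big_cons /=.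
    by rewrite {1}def_q; ring.
  - rewrite size_rem // (leq_trans _ sm) // prednK // lt0n size_eq0.
    by apply: contraTneq qs => ->.
have {}primf : primitive f by move=> p prp pf; apply: primf; exists p.
have [f1|f1] := leqP (size f) 1.
  apply: prime_product_unit; have def_f := size1_polyC f1.
  rewrite def_f in f0 primf *; rewrite polyC_eq0 in f0.
  apply: contraT => fU.
  have [|p prp [c def_c]] := nonunit_prime_divisor factR f0.
    by apply: contra fU; apply: rmorph_unit.
  by case: (primf p prp); exists c%:P; rewrite def_c polyCM.
have [[g [h [def_f g1 h1]]]|irrf] :=
  pselect (exists g h, [/\ f = g * h, (1 < size g)%N & (1 < size h)%N]).
  have [g0 h0] : g != 0 /\ h != 0 by rewrite -!size_poly_gt0 (ltnW g1) (ltnW h1).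
  have sf : (size f).+1 = (size g + size h)%N.
    by rewrite def_f size_mul // prednK // addn_gt0 size_poly_gt0 g0.
  by rewrite def_f; apply: prime_productM; apply: IHn => //; lia.
apply/prime_product_prime/primitive_irreducible_prime => // g h def_f.
have [|g1] := leqP (size g) 1; first by left.
by right; rewrite leqNgt; apply/negP=> h1; apply: irrf; exists g, h.
Qed.
End Gauss.

Lemma factorial_can (R S : idomainType) (f : {rmorphism R -> S})
    (g : {rmorphism S -> R}) : cancel f g -> cancel g f ->
  factorial_ring R -> factorial_ring S.
Proof.
move=> fK gK factR a a0; have [|s [u [uU prs def_a]]] := factR (g a).
  by rewrite -(inj_eq (can_inj gK)) rmorph0 in a0.
exists (map f s), (f u); split; first exact: rmorph_unit.
  move=> _ /mapP[p /prs[p0 pU prp] ->]; split=> [||b c [d def_d]].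
  - by rewrite -(inj_eq (can_inj gK)) fK rmorph0.
  - by apply: contra pU => /(rmorph_unit g); rewrite fK.
  have [|[e def_e]|[e def_e]] := prp (g b) (g c).
  - by exists (g d); rewrite -rmorphM def_d rmorphM fK.
  - by left; exists (f e); rewrite -rmorphM -def_e gK.
  - by right; exists (f e); rewrite -rmorphM -def_e gK.
by rewrite -(gK a) def_a rmorphM rmorph_prod big_map.
Qed.

Section MpolyFactorial.
Variables (F : fieldType) (n : nat).

Let commX (f : {mpoly F[n]}) : GRing.comm ('X_ord_max : {mpoly F[n.+1]}) (mwiden f).
Proof. exact: mulrC. Qed.

Let multi : {rmorphism {poly {mpoly F[n]}} -> {mpoly F[n.+1]}} :=
  horner_morph commX.

Lemma muniX (m : 'X_{1..n.+1}) : muni 'X_[F, m] =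
  'X_[F, [multinom (m (widen_ord (leqnSn n) i)) | i < n]] *: 'X^(m ord_max).
Proof. by rewrite muniE msuppX big_seq1 mcoeffX eqxx scale1r. Qed.

Lemma multi_muniK : cancel (@muni n F) multi.
Proof.
move=> f; rewrite [in RHS](mpolyE f) [in LHS](mpolyE f).
rewrite (raddf_sum (@muni n F)) (raddf_sum multi).
apply: eq_bigr => m _; transitivity (multi (muni (f@_m *: 'X_[m]))) => //.
rewrite muniZ muniX scalerA -mul_polyC rmorphM /=.
rewrite horner_morphC rmorphXn /= horner_morphX mwidenM mwidenC mwidenX.
rewrite -mulrA mul_mpolyC; congr (_ *: _); rewrite mpolyXn -mpolyXD; congr 'X_[_].
apply/mnmP=> i; rewrite mnmDE mulmnE mnm1E.
case: (unliftP ord_max i) => [j|] ->; last first.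
  by rewrite mnmwiden_ordmax eqxx mul1n.
have -> : lift ord_max j = widen_ord (leqnSn n) j by apply/val_inj/lift_max.
by rewrite mnmwiden_widen mnmE -val_eqE /= gtn_eqF ?mul0n ?addn0 //.
Qed.

Lemma muni_mwiden (f : {mpoly F[n]}) : muni (mwiden f) = f%:P.
Proof.
rewrite [in RHS](mpolyE f) [in LHS](mpolyE f) (raddf_sum (@mwiden n F)).
rewrite (raddf_sum (@muni n F)) (raddf_sum polyC).
apply: eq_bigr => m _; transitivity (muni (mwiden (f@_m *: 'X_[m]))) => //.
rewrite mwidenZ muniZ mwidenX muniX mnmwiden_ordmax expr0.
rewrite alg_polyC scale_polyC mul_mpolyC; congr (_ *: 'X_[_])%:P.
by apply/mnmP=> i; rewrite mnmE mnmwiden_widen.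
Qed.

Lemma muni_multiK : cancel multi (@muni n F).
Proof.
elim/poly_ind => [|f c IHf]; first by rewrite !rmorph0.
rewrite !rmorphD !rmorphM /= IHf horner_morphX horner_morphC muniX muni_mwiden.
rewrite mnm1E eqxx expr1; congr (_ * _ + _).
rewrite -[RHS]scale1r -mpolyX0; congr ('X_[_] *: _); apply/mnmP=> i.
by rewrite mnmE mnm1E mnm0E -val_eqE /= gtn_eqF.
Qed.

End MpolyFactorial.

Lemma factorial_mpoly (F : fieldType) n : factorial_ring {mpoly F[n]}.
Proof.
elim: n => [|n IHn].
  move=> f f0; apply: prime_product_unit; rewrite (nvar0_mpolyC f) in f0 *.
  by apply: rmorph_unit; rewrite unitfE; apply: contraNneq f0 => ->; rewrite rmorph0.
apply: (factorial_can (@muni_multiK F n) (@multi_muniK F n)).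
exact: factorial_poly.
Qed.

Lemma mpirreducible_prime (F : fieldType) n (p : {mpoly F[n]}) :
  mpirreducible p -> prime_elt p.
Proof. by case; apply/irreducible_prime/factorial_mpoly. Qed.

Lemma prime_irreducible (R : idomainType) (p a b : R) : prime_elt p -> p = a * b ->
  a \is a GRing.unit \/ b \is a GRing.unit.
Proof.
case=> p0 _ prp def_p.
have unit_cofactor c d : p = c * d -> divides p c -> d \is a GRing.unit.
  move=> def [e def_c]; apply/unitrPr; exists e; apply: (mulfI p0).
  by rewrite mulr1 [RHS]def def_c; ring.
have [|pa|pb] := prp a b; first by rewrite -def_p; apply: divides_refl.
  by right; apply: unit_cofactor pa.
by left; apply: unit_cofactor pb; rewrite mulrC.
Qed.

Lemma prod_primes_divides (R : idomainType) (I : eqType) (s : seq I)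
    (E : I -> R) (f : R) :
    uniq s -> (forall i, i \in s -> prime_elt (E i) /\ divides (E i) f) ->
    (forall i j, i \in s -> j \in s -> divides (E i) (E j) -> i = j) ->
  divides (\prod_(i <- s) E i) f.
Proof.
elim: s => [_ _ _|i s IHs /= /andP[i_s us] prs inj].
  by rewrite big_nil; exists f; rewrite mulr1.
have [|j k js ks|c def_f] := IHs us.
- by move=> j js; apply: prs; rewrite inE js orbT.
- by apply: inj; rewrite inE ?js ?ks orbT.
have [prEi Eif] := prs i (mem_head _ _).
have [_ _ prP] := prEi; rewrite def_f in Eif.
have [[d def_c]|/(prime_divides_prod prEi)[j js Eij]] := prP _ _ Eif.
  by exists d; rewrite big_cons def_f def_c mulrA.
have ij : i = j by apply: inj => //; rewrite inE ?eqxx ?js ?orbT.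
by rewrite ij js in i_s.
Qed.

(** * Vector degrees and normalized polynomials *)

Section VectorDegree.
Variables (F : fieldType) (k : nat).
Implicit Types (f g : {mpoly F[k]}) (i : 'I_k).

(* Multiplies x_i by a new variable, which turns the degree in x_i into the
   size of a univariate polynomial. *)
Definition mark_var i : {mpoly F[k]} -> {poly {mpoly F[k]}} :=
  mmap (polyC \o @mpolyC k F) (fun j => 'X_j *: 'X^(i == j)).

Lemma mark_varM i : {morph mark_var i : f g / f * g}.
Proof. by move=> f g; rewrite /mark_var rmorphM. Qed.

Lemma mark_varE i f :
  mark_var i f = \sum_(m <- msupp f) (f@_m *: 'X_[m]) *: 'X^(m i).
Proof.
apply: eq_bigr => m _; rewrite /= mul_polyC -mul_mpolyC -scalerA; congr (_ *: _).
rewrite /mmap1 (eq_bigr (fun j => ('X_j ^+ m j)%:P * 'X^((i == j) * m j))); last first.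
  by move=> j _; rewrite -mul_polyC exprMn polyC_exp exprM.
rewrite big_split /= -rmorph_prod -mpolyXE_id mul_polyC prodrXr; congr (_ *: 'X^_).
rewrite (bigD1 i) //= eqxx mul1n big1 ?addn0 // => j.
by rewrite eq_sym => /negPf->.
Qed.

Lemma coef_mark_var i f e (m : 'X_{1..k}) : m i = e -> ((mark_var i f)`_e)@_m = f@_m.
Proof.
move=> mi; rewrite mark_varE coef_sum raddf_sum /= [in RHS](mpolyE f) raddf_sum /=.
apply: eq_bigr => u _; rewrite coefZ coefXn -mi.
rewrite mulr_natr mcoeffMn !mcoeffZ mcoeffX.
by have [->|] := eqVneq u m; rewrite ?eqxx ?mulr0 ?mul0rn.
Qed.

Lemma Deg_ge f m i : m \in msupp f -> (m i <= Deg f i)%N.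
Proof. by move=> mf; rewrite mnmE (bigD1_seq m) //= leq_maxl. Qed.

Lemma size_mark_var i f : f != 0 -> size (mark_var i f) = (Deg f i).+1.
Proof.
move=> f0; apply/eqP; rewrite eqn_leq; apply/andP; split.
  apply/leq_sizeP => e De; rewrite mark_varE coef_sum big1_seq // => m /andP[_ mf].
  by rewrite coefZ coefXn gtn_eqF ?mulr0 // (leq_ltn_trans (Deg_ge i mf)).
have lt_size m : m \in msupp f -> (m i < size (mark_var i f))%N.
  rewrite mcoeff_msupp ltnNge; apply: contra => le.
  by rewrite -(@coef_mark_var i f (m i) m) // nth_default // mcoeff0.
have [m mf] : exists m, m \in msupp f.
  by exists (mlead f); apply: mlead_supp.
rewrite -(prednK (leq_ltn_trans (leq0n _) (lt_size m mf))) ltnS mnmE.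
apply/bigmax_leqP_seq => u uf _.
by rewrite -ltnS prednK ?lt_size // (leq_ltn_trans (leq0n _) (lt_size m mf)).
Qed.

Lemma DegM f g : f != 0 -> g != 0 -> Deg (f * g) = (Deg f + Deg g)%MM.
Proof.
move=> f0 g0; apply/mnmP=> i; apply: succn_inj; rewrite mnmDE.
have s0 h : h != 0 -> mark_var i h != 0.
  by move=> h0; rewrite -size_poly_gt0 size_mark_var.
have E : size (mark_var i (f * g)) = (size (mark_var i f) + size (mark_var i g)).-1.
  by rewrite mark_varM; apply: size_mul; apply: s0.
have fg0 : f * g != 0 by apply: mulf_neq0.
have := etrans (esym (size_mark_var i fg0)) (etrans E
  (congr1 predn (congr2 addn (size_mark_var i f0) (size_mark_var i g0)))).
by rewrite [in RHS]addSn addnS.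
Qed.

Lemma mpoly_unitP f : reflect (exists2 c, c != 0 & f = c%:MP) (f \is a GRing.unit).
Proof.
apply: (iffP andP) => [[/eqP def_f cU]|[c c0 ->]].
  by exists f@_0; rewrite // -unitfE.
by rewrite mcoeffC eqxx mulr1 eqxx unitfE.
Qed.

Lemma divides_neq0 f g : divides f g -> g != 0 -> f != 0.
Proof. by case=> h -> /[!mulf_eq0] /norP[]. Qed.

End VectorDegree.

Lemma card_fset_image (T T' : choiceType) (f : T -> T') (A : {fset T}) :
  {in A &, injective f} -> #|` [fset f x | x in A]%fset| = #|` A|.
Proof. by move=> fI; rewrite card_in_imfset. Qed.

Section Classes.
Variables (F : finFieldType) (k : nat).
Implicit Types (f g p : {mpoly F[k]}) (x y h : normpoly F k).

Lemma npclass_repr h : npclass (repr h) = h.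
Proof. exact: reprK. Qed.

Lemma repr_npclass f : exists2 c : F, c != 0 & repr (npclass f) = c *: f.
Proof. by apply/npclassP/eqP/npclass_repr. Qed.

Lemma npclass_assoc f g : divides f g -> divides g f -> npclass f = npclass g.
Proof.
have [->|f0] := eqVneq f 0; first by case=> c ->; rewrite mulr0.
case=> a -> [b def_f]; apply/eqP/npclassP.
have /mpoly_unitP[c c0 def_b] : b \is a GRing.unit.
  apply/unitrPr; exists a; apply: (mulIf f0).
  by rewrite mul1r -mulrA -def_f.
by exists c => //; rewrite {1}def_f def_b mul_mpolyC.
Qed.

Lemma divides_repr_npclass f :
  divides (repr (npclass f)) f /\ divides f (repr (npclass f)).
Proof.
have [c c0 ->] := repr_npclass f; split; last by exists c%:MP; rewrite mul_mpolyC.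
by exists c^-1%:MP; rewrite mul_mpolyC scalerA mulVf ?scale1r.
Qed.

Lemma mem_normpolys_repr m h :
  (h \in normpolys F m) = (repr h != 0) && (Deg (repr h) == m).
Proof. by rewrite -{1}(npclass_repr h) mem_normpolys. Qed.

Definition has_divisor f h : bool := `[< divides (repr h) f >].

Definition npmul x y : normpoly F k := npclass (repr x * repr y).

Lemma card_multiples m d h : h \in normpolys F d ->
  #|` [fset f in normpolys F m | has_divisor (repr f) h]%fset| =
  if (d <= m)%MM then Nk F (m - d)%MM else 0%N.
Proof.
rewrite mem_normpolys_repr => /andP[h0 /eqP Dh].
case: ifP => dm; last first.
  apply/eqP; rewrite cardfs_eq0; apply/eqP/fsetP => f; rewrite !inE /=.
  apply/negP=> /andP[]; rewrite mem_normpolys_repr.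
  move=> /andP[f0 /eqP Df] /asboolP[g def_f].
  case/negP: (negbT dm); rewrite -Df -Dh def_f DegM ?lem_addl //.
  by move: f0; rewrite def_f mulf_eq0 => /norP[].
transitivity #|` [fset npmul h x | x in normpolys F (m - d)%MM]%fset|; last first.
  apply: card_fset_image.
  move=> x y _ _ /eqP /npclassP[c c0 def]; rewrite -(npclass_repr x) -(npclass_repr y).
  by apply/eqP/npclassP; exists c => //; apply: (mulfI h0); rewrite def scalerAr.
congr #|` _|; apply/fsetP => f; rewrite !inE /=; apply/andP/imfsetP => /=.
  rewrite mem_normpolys_repr => -[/andP[f0 /eqP Df] /asboolP[g def_f]].
  have g0 : g != 0 by move: f0; rewrite def_f mulf_eq0 => /norP[].
  exists (npclass g).
    rewrite mem_normpolys g0 -Df def_f DegM // Dh; apply/eqP.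
    by rewrite addmK.
  rewrite -{1}(npclass_repr f); apply/eqP/npclassP.
  have [c c0 ->] := repr_npclass g; exists c^-1; first by rewrite invr_eq0.
  by rewrite -scalerAr scalerA mulVf // scale1r def_f mulrC.
move=> [x]; rewrite mem_normpolys_repr => /andP[x0 /eqP Dx] ->.
rewrite mem_normpolys mulf_neq0 //= DegM // Dh Dx addmC submK // eqxx; split=> //.
apply/asboolP; have [_] := divides_repr_npclass (repr h * repr x).
by apply: divides_trans; exists (repr x); rewrite mulrC.
Qed.

Lemma mpirreducibleP p : mpirreducible p <-> prime_elt p.
Proof.
split; first exact: mpirreducible_prime.
by move=> prp; have [p0 pU _] := prp; split=> // a b; apply: prime_irreducible.
Qed.

Lemma prime_repr_inj x y : prime_elt (repr x) -> prime_elt (repr y) ->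
  divides (repr x) (repr y) -> x = y.
Proof.
move=> prx pry xy; rewrite -(npclass_repr x) -(npclass_repr y).
apply: npclass_assoc => //; have [u uU ->] := prime_divides_assoc prx pry xy.
by exists u^-1; rewrite mulKr.
Qed.

Lemma factorization_unique h (S S' : {fset normpoly F k}) :
    distinct_irreducible_factorization h S ->
    distinct_irreducible_factorization h S' -> S = S'.
Proof.
have sub (T T' : {fset normpoly F k}) : distinct_irreducible_factorization h T ->
    distinct_irreducible_factorization h T' -> (T `<=` T')%fset.
  move=> [irrT defT] [irrT' defT']; apply/fsubsetP=> x xT.
  have prx := mpirreducible_prime (irrT x xT).
  have [|y yT' xy] := @prime_divides_prod _ (repr x) _ T' repr prx.
    have [c c0 def] : exists2 c : F, c != 0 &
        \prod_(p <- T') repr p = c *: \prod_(p <- T) repr p.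
      by apply/npclassP; rewrite -defT -defT'.
    rewrite def -mul_mpolyC; apply: divides_mull.
    by rewrite (big_fsetD1 x) //=; apply/divides_mulr/divides_refl.
  by rewrite (prime_repr_inj prx (mpirreducible_prime (irrT' y yT')) xy).
by move=> hS hS'; apply/eqP; rewrite eqEfsubset !sub.
Qed.

Lemma muE h (S : {fset normpoly F k}) : distinct_irreducible_factorization h S ->
  mu h = (-1) ^+ #|` S|.
Proof.
move=> hS; rewrite /mu; case: pselect => [ex|[]]; last by exists S.
by case: (cid ex) => T hT /=; rewrite (factorization_unique hT hS).
Qed.

Lemma mu_eq0 h : ~ (exists S, distinct_irreducible_factorization h S) -> mu h = 0.
Proof. by rewrite /mu; case: pselect. Qed.

Lemma norm_mu h : `|mu h| <= 1.
Proof.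
by rewrite /mu; case: pselect => [ex|_]; rewrite ?normr0 // normrX normrN1 expr1n.
Qed.

Lemma prime_repr_npclass p : prime_elt p -> prime_elt (repr (npclass p)).
Proof.
case=> p0 pU prp; have [pc cp] := divides_repr_npclass p; split.
- by have [c c0 ->] := repr_npclass p; rewrite scaler_eq0 negb_or c0.
- by apply: contra pU => cU; apply: divides_unit cU cp.
- move=> a b cab; have [pa|pb] := prp a b (divides_trans cp cab).
    by left; apply: divides_trans pa.
  by right; apply: divides_trans pb.
Qed.

Lemma common_primes f g : f != 0 -> exists PP : {fset normpoly F k}, forall y,
  y \in PP <-> [/\ prime_elt (repr y), divides (repr y) f & divides (repr y) g].
Proof.
move=> f0; have [s [u [uU prs def_f]]] := factorial_mpoly f0.
exists [fset y in [fset npclass p | p in s] | has_divisor g y]%fset => y.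
rewrite !inE /=; split=> [/andP[/imfsetP[/= p ps ->] /asboolP yg]|[pry yf yg]].
  have [pc _] := divides_repr_npclass p; split=> //; first exact/prime_repr_npclass/prs.
  apply: divides_trans pc _; rewrite def_f; apply: divides_mull.
  by rewrite (big_rem p) //=; apply/divides_mulr/divides_refl.
have [y0 yU prY] := pry; move: yf; rewrite def_f => /prY[/(divides_unit uU)|].
  by rewrite (negPf yU).
case/(prime_divides_prod pry) => p ps yp.
apply/andP; split; last exact/asboolP.
apply/imfsetP; exists p => //=.
have [v vU def_p] := prime_divides_assoc pry (prs p ps) yp.
rewrite -{1}(npclass_repr y); apply: npclass_assoc => //.
by exists v^-1; rewrite def_p mulKr.
Qed.
End Classes.

(** * Moebius inversion *)

Lemma sum_signed_subsets (T : finType) :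
  \sum_(A : {set T}) (-1) ^+ #|A| = (#|T| == 0%N)%:Z.
Proof.
transitivity (\prod_(x : T) (-1 + 1 : int)); last first.
  by rewrite prodr_const addNr expr0n -natz.
rewrite (bigA_distr _ _ (fun=> -1 : int) (fun=> 1)); apply: eq_bigr => A _.
by rewrite -big_mkcond prodr_const.
Qed.

Section Moebius.
Variables (F : finFieldType) (k : nat).
Implicit Types (f g p : {mpoly F[k]}) (x y h : normpoly F k).

Lemma normpolys_inj (d e : 'X_{1..k}) h :
  h \in normpolys F d -> h \in normpolys F e -> d = e.
Proof. by rewrite !mem_normpolys_repr => /andP[_ /eqP<-] /andP[_ /eqP->]. Qed.

Lemma mdeg_le (d e : 'X_{1..k}) : (d <= e)%MM -> (mdeg d <= mdeg e)%N.
Proof. by move/mnm_lepP=> de; rewrite !mdegE; apply: leq_sum. Qed.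

Lemma sum_classes_eq (V : nmodType) (t : 'X_{1..k}) y (v : V) :
    repr y != 0 -> (Deg (repr y) <= t)%MM ->
  \sum_(d : 'X_{1..k < (mdeg t).+1} | (d <= t)%MM) \sum_(h <- normpolys F d)
     (if h == y then v else 0) = v.
Proof.
move=> y0 Dy.
have dP : (mdeg (Deg (repr y)) < (mdeg t).+1)%N by rewrite ltnS mdeg_le.
have yN : y \in normpolys F (BMultinom dP) by rewrite mem_normpolys_repr y0 /=.
rewrite (bigD1 (BMultinom dP)) //= [X in _ + X]big1 ?addr0 => [|d /andP[_ ne]].
  rewrite (big_fsetD1 y) //= eqxx big1_seq ?addr0 // => h /andP[_].
  by rewrite !inE => /andP[/negPf->].
rewrite big1_seq // => h /andP[_ hd]; case: eqP => // def_h.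
by case/eqP: ne; apply: val_inj; apply: normpolys_inj hd _; rewrite def_h.
Qed.

Lemma sum_mu_common_divisors (t : 'X_{1..k}) f g : f != 0 -> g != 0 ->
    (forall h, divides (repr h) f -> divides (repr h) g -> (Deg (repr h) <= t)%MM) ->
  \sum_(d : 'X_{1..k < (mdeg t).+1} | (d <= t)%MM) \sum_(h <- normpolys F d)
     (if has_divisor f h && has_divisor g h then mu h else 0) = `[< mpcoprime f g >]%:Z.
Proof.
move=> f0 g0 good; have [PP PPP] := common_primes g f0.
have prPP (x : PP) : [/\ prime_elt (repr (val x)),
    divides (repr (val x)) f & divides (repr (val x)) g].
  by apply/PPP/valP.
pose y (A : {set PP}) := npclass (\prod_(x in A) repr (val x)).
pose S (A : {set PP}) : {fset normpoly F k} := [fset val x | x in A]%fset.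
have memS (A : {set PP}) (x : PP) : (val x \in S A) = (x \in A).
  by rewrite mem_imfset //; apply: val_inj.
have SP A : distinct_irreducible_factorization (y A) (S A).
  split=> [p /imfsetP[x _ ->]|]; first by apply/mpirreducibleP; have [] := prPP x.
  by rewrite /y /S big_imfset /= ?big_enum //; move=> ? ? _ _; apply: val_inj.
have cardS A : #|` S A| = #|A|.
  by rewrite card_imfset /= ?cardE //; apply: val_inj.
have Sinj A B : S A = S B -> A = B.
  by move=> eqS; apply/setP=> x; rewrite -!memS eqS.
have prod_dvd (q : {mpoly F[k]}) : (forall x : PP, divides (repr (val x)) q) ->
    forall A : {set PP}, divides (\prod_(x in A) repr (val x)) q.
  move=> dq A; rewrite -big_enum /=; apply: prod_primes_divides; first exact: enum_uniq.
    by move=> x _; split; [have [] := prPP x | apply: dq].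
  move=> x x' _ _; have [prx _ _] := prPP x; have [prx' _ _] := prPP x'.
  by move/(prime_repr_inj prx prx')/val_inj.
have yf A : divides (repr (y A)) f /\ divides (repr (y A)) g.
  split; apply: divides_trans (divides_repr_npclass _).1 _; apply: prod_dvd => x.
    by have [] := prPP x.
  by have [] := prPP x.
have factS h T : distinct_irreducible_factorization h T ->
    has_divisor f h -> has_divisor g h ->
    exists A, S A = T /\ y A = h.
  move=> hT /asboolP hf /asboolP hg; have [irrT defh] := hT.
  have TPP x : x \in T -> x \in PP.
    move=> xT; have xh : divides (repr x) (repr h).
      rewrite defh; apply: divides_trans (divides_repr_npclass _).2.
      by rewrite (big_fsetD1 x) //=; apply/divides_mulr/divides_refl.
    apply/PPP; split; first exact/mpirreducibleP/irrT.
      exact: divides_trans hf.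
    exact: divides_trans hg.
  pose A := [set x : PP | val x \in T]; have defT : S A = T.
    apply/fsetP=> x; apply/idP/idP => [/imfsetP[/= x' + ->]|xT]; first by rewrite inE.
    by rewrite -[x]/(val [` TPP x xT]%fset) memS inE.
  by exists A; split=> //; rewrite defh -defT; have [_ ->] := SP A.
have -> : `[< mpcoprime f g >]%:Z = (#|{: PP}| == 0%N)%:Z.
  congr (nat_of_bool _)%:Z; apply/asboolP/eqP => [cop|PP0 d df dg].
    apply/eqP/pred0P=> x /=; apply/negbTE/negP=> _; have [[_ xU _] xf xg] := prPP x.
    have := cop _ xf xg; move/(divides_unit (unitr1 _)); exact/negP.
  have [/unitrPr[e de]|dU] := boolP (d \is a GRing.unit).
    by exists e; rewrite mulrC.
  have [p prp pd] :=
    nonunit_prime_divisor (@factorial_mpoly F k) (divides_neq0 df f0) dU.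
  suff pPP : npclass p \in PP by have := fintype0 [` pPP]%fset PP0.
  have [pc _] := divides_repr_npclass p.
  have dvdp q : divides d q -> divides (repr (npclass p)) q.
    by move=> dq; apply: divides_trans (divides_trans pc pd) dq.
  by apply/PPP; split; [exact: prime_repr_npclass | exact: dvdp | exact: dvdp].
rewrite -sum_signed_subsets.
transitivity (\sum_(A : {set PP}) \sum_(d : 'X_{1..k < (mdeg t).+1} | (d <= t)%MM)
    \sum_(h <- normpolys F d) (if h == y A then (-1) ^+ #|A| else 0 : int)); last first.
  apply: eq_bigr => A _; have [Af Ag] := yf A.
  rewrite sum_classes_eq //; last exact: good.
  exact: divides_neq0 Af f0.
rewrite exchange_big; apply: eq_bigr => d _; rewrite exchange_big.
apply: eq_bigr => h _ /=.
have [[A defh]|noA] := pselect (exists A, y A = h).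
  have [Af Ag] := yf A; rewrite defh in Af Ag; rewrite /has_divisor !asboolT //=.
  rewrite (bigD1 A) //= defh eqxx big1 ?addr0 => [|B ne].
    by rewrite -defh (muE (SP A)) cardS.
  case: eqP => // eqB; case/eqP: ne; apply: Sinj; apply: factorization_unique (SP B) _.
  by rewrite -eqB -defh.
rewrite big1 => [|A _]; last by case: eqP => // eqA; case: noA; exists A.
case: ifP => // /andP[hf hg]; apply: mu_eq0 => -[T hT].
by have [A [_ yA]] := factS h T hT hf hg; apply: noA; exists A.
Qed.
End Moebius.

(** * Counting polynomials and the error exponent *)

Lemma Nk_le (F : finFieldType) k (m : 'X_{1..k}) :
  (Nk F m <= #|F| ^ \prod_(i < k) (m i).+1)%N.
Proof.
apply: leq_trans (leq_imfset_card _ _ _) _ => /=.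
pose T := {dffun forall i : 'I_k, 'I_(m i).+1}.
pose mon (u : T) : 'X_{1..k} := [multinom val (u i) | i < k].
have -> : (\prod_(i < k) (m i).+1 = #|T|)%N.
  rewrite card_dep_ffun foldrE big_map big_enum /=.
  by apply: eq_bigr => i _; rewrite card_ord.
rewrite -card_ffun.
pose G (c : {ffun T -> F}) : {mpoly F[k]} := \sum_(u : T) c u *: 'X_[mon u].
suff /fsubset_leq_card/leq_trans : (polys F m `<=` [fset G c | c in {ffun T -> F}])%fset.
  by apply; rewrite (leq_trans (leq_imfset_card _ _ _)) //= -cardE.
apply/fsubsetP => f; rewrite mem_polys => /andP[f0 /eqP Df].
apply/imfsetP; exists [ffun u => f@_(mon u)] => //=; apply/mpolyP => v.
rewrite raddf_sum /=.
have [vm|vm] := boolP (v <= m)%MM.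
  have vi i : (v i < (m i).+1)%N by rewrite ltnS; move/mnm_lepP: vm.
  pose u0 : T := [ffun i => Ordinal (vi i)].
  have monu0 : mon u0 = v by apply/mnmP=> i; rewrite mnmE ffunE.
  rewrite (bigD1 u0) //= big1 => [|u ne].
    by rewrite addr0 mcoeffZ mcoeffX ffunE monu0 eqxx mulr1.
  rewrite mcoeffZ mcoeffX; case: eqP => [def_v|_]; last by rewrite mulr0.
  case/eqP: ne; apply/ffunP=> i; apply: val_inj.
  by rewrite ffunE /= -def_v mnmE.
rewrite big1 => [|u _]; last first.
  rewrite mcoeffZ mcoeffX; case: eqP => [def_v|_]; last by rewrite mulr0.
  by case/mnm_lepP: vm => i; rewrite -def_v mnmE -ltnS ltn_ord.
apply/memN_msupp_eq0; apply: contra vm => vf.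
by rewrite -Df; apply/mnm_lepP => i; apply: Deg_ge.
Qed.

Section Exponent.
Local Open Scope nat_scope.

Lemma prodS_superadditive (I : finType) (P : pred I) (a b : I -> nat) :
  \prod_(i | P i) (a i).+1 + \prod_(i | P i) (b i).+1 <=
  (\prod_(i | P i) (a i + b i).+1).+1.
Proof.
have pos (c : I -> nat) : 0 < \prod_(i | P i) (c i).+1 by apply: prodn_gt0.
suff [] : [/\ \prod_(i | P i) (a i).+1 + \prod_(i | P i) (b i).+1 <=
  (\prod_(i | P i) (a i + b i).+1).+1, 0 < \prod_(i | P i) (a i).+1 &
  0 < \prod_(i | P i) (b i).+1] by [].
elim/big_rec3: _ => // i C B A _ [le A0 B0]; split; nia.
Qed.

Lemma sum_lt_prodS (I : finType) (P : pred I) (a : I -> nat) :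
  \sum_(i | P i) a i < \prod_(i | P i) (a i).+1.
Proof. by elim/big_rec2: _ => // i p s _; nia. Qed.

(* The left side is affine in each coordinate of d; its extremal case
   d = (t j + 1) U_(j) gives the error exponent up to a constant.  The extra
   term [mdeg d] makes the sum over d geometric. *)
Lemma exponent_le k (t m n d : 'X_{1..k}) (j : 'I_k) :
    (d <= m)%MM -> (d <= n)%MM -> t j < d j -> 2 * t j + 1 < maxn (m j) (n j) ->
  \prod_(i < k) (d i).+1 + \prod_(i < k) ((m - d)%MM i).+1 +
    \prod_(i < k) ((n - d)%MM i).+1 + mdeg d
  <= error_exponent t m n + (2 * mdeg t + 3).
Proof.
move=> /mnm_lepP dm /mnm_lepP dn tdj mxj.
have tj : t j <= mdeg t by rewrite mdegE (bigD1 j) //= leq_addr.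
have prodE (a : 'X_{1..k}) :
    \prod_(i < k) (a i).+1 = (a j).+1 * \prod_(i < k | i != j) (a i).+1.
  by rewrite (bigD1 j).
apply: leq_trans (_ : ((m j - t j) * \prod_(i < k | i != j) (m i).+1 +
    (n j - t j) * \prod_(i < k | i != j) (n i).+1) + (2 * mdeg t + 3) <= _); last first.
  rewrite leq_add2r /error_exponent.
  apply: leq_trans (leq_bigmax j).
  by rewrite (prodE m) (prodE n) ![(_ - _) * (_ * _)]mulnCA !mulKn.
rewrite mdegE [\sum_(i < k) _](bigD1 j) //=.
rewrite (prodE d) (prodE (m - d)%MM) (prodE (n - d)%MM) !mnmBE.
set D := \prod_(i < k | i != j) (d i).+1.
set M := \prod_(i < k | i != j) (m i).+1; set N := \prod_(i < k | i != j) (n i).+1.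
set M' := \prod_(i < k | i != j) ((m - d)%MM i).+1.
set N' := \prod_(i < k | i != j) ((n - d)%MM i).+1.
set s := \sum_(i < k | i != j) d i.
have sD : s < D by apply: sum_lt_prodS.
have DM : D + M' <= M.+1.
  apply: leq_trans (prodS_superadditive _ _ _) _; rewrite ltnS.
  by apply: leq_prod => i _; rewrite mnmBE subnKC.
have DN : D + N' <= N.+1.
  apply: leq_trans (prodS_superadditive _ _ _) _; rewrite ltnS.
  by apply: leq_prod => i _; rewrite mnmBE subnKC.
have M'0 : 0 < M' by apply: prodn_gt0.
have N'0 : 0 < N' by apply: prodn_gt0.
have := dm j; have := dn j; move: (m j) (n j) (d j) (t j) tj tdj mxj.
clearbody D M N M' N' s; clear dm dn.
move=> a b c e te ec mab cb ca.
have [x def_c] : exists x, c = e.+1 + x by exists (c - e.+1); lia.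
have [a' def_a] : exists a', a = c + a' by exists (a - c); lia.
have [b' def_b] : exists b', b = c + b' by exists (b - c); lia.
subst c a b.
have -> : e.+1 + x + a' - (e.+1 + x) = a' by lia.
have -> : e.+1 + x + b' - (e.+1 + x) = b' by lia.
have -> : e.+1 + x + a' - e = x + a' + 1 by lia.
have -> : e.+1 + x + b' - e = x + b' + 1 by lia.
have [D' def_D] : exists D', D = D'.+1 by exists D.-1; lia.
subst D.
have MD : M' + D' <= M by lia.
have ND : N' + D' <= N by lia.
have h1 : (x + a' + 1) * (M' + D') <= (x + a' + 1) * M by rewrite leq_mul2l MD orbT.
have h2 : (x + b' + 1) * (N' + D') <= (x + b' + 1) * N by rewrite leq_mul2l ND orbT.
have h3 : x * 2 <= x * (M' + N') by rewrite leq_mul2l; lia.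
have h4 : (e + x + 2) * D' <= (2 * x + a' + b' + 1) * D' by rewrite leq_mul2r; lia.
lia.
Qed.

End Exponent.

Lemma sum_half_le2 B : \sum_(i < B) (2^-1 : rat) ^+ i <= 2.
Proof.
have := subrX1 (2^-1 : rat) B; have : 0 <= (2^-1 : rat) ^+ B by apply: exprn_ge0.
lra.
Qed.

Lemma sum_half_mdeg_le k B :
  \sum_(d : 'X_{1..k < B}) (2^-1 : rat) ^+ mdeg d <= 2 ^+ k.
Proof.
have ltB (d : 'X_{1..k < B}) i : (d i < B)%N.
  apply: leq_ltn_trans (bmdeg d); rewrite mdegE (bigD1 i) //=; exact: leq_addr.
pose phi (d : 'X_{1..k < B}) : {ffun 'I_k -> 'I_B} := [ffun i => Ordinal (ltB d i)].
have phiI : injective phi.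
  move=> d e /ffunP eq; apply/val_inj/mnmP => i.
  by have := congr1 val (eq i); rewrite !ffunE.
pose G (u : {ffun 'I_k -> 'I_B}) : rat := \prod_(i < k) 2^-1 ^+ u i.
have G0 u : 0 <= G u by apply: prodr_ge0 => i _; apply: exprn_ge0.
apply: (@le_trans _ _ (\sum_u G u)).
  rewrite (eq_bigr (fun d => G (phi d))) => [|d _]; last first.
    by rewrite mdegE -prodrXr; apply: eq_bigr => i _; rewrite ffunE.
  rewrite -(big_imset (A := predT) G (in2W phiI)) big_mkcond /=.
  by apply: ler_sum => u _; case: ifP.
rewrite /G -(bigA_distr_bigA (fun (i : 'I_k) (j : 'I_B) => (2^-1 : rat) ^+ j)).
rewrite prodr_const card_ord; apply: lerXn2r;
  rewrite ?nnegrE //; last exact: sum_half_le2.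
by apply: sumr_ge0 => i _; apply: exprn_ge0.
Qed.

Lemma sum_exp_le k B (q e : nat) (P : pred 'X_{1..k < B}) (phi : 'X_{1..k < B} -> nat) :
    (2 <= q)%N -> (forall d, P d -> (phi d + mdeg d <= e)%N) ->
  (\sum_(d | P d) q ^ phi d <= 2 ^ k * q ^ e)%N.
Proof.
move=> q2 le_e; rewrite -(ler_nat rat) natr_sum natrM natrX mulrC.
apply: le_trans (ler_wpM2l (ler0n _ _) (sum_half_mdeg_le k B)).
rewrite mulr_sumr [leRHS](bigID P) /= -[leLHS]addr0; apply: lerD; last first.
  by apply: sumr_ge0 => d _; rewrite mulr_ge0 ?exprn_ge0.
apply: ler_sum => d Pd; rewrite exprVn ler_pdivlMr ?exprn_gt0 // -natrX -natrM ler_nat.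
apply: leq_trans (leq_pexp2l _ (le_e d Pd)); last exact: ltnW.
rewrite expnD leq_mul2l; case: (mdeg d) => [|e']; first by rewrite !expn0 orbT.
by rewrite leq_exp2r // q2 orbT.
Qed.

(** * The truncated Moebius sum *)

Lemma card_fset_filter (T : choiceType) (A : {fset T}) (P : pred T) :
  (#|` [fset x in A | P x]%fset| = \sum_(x <- A) P x)%N.
Proof. by rewrite card_fset_sum1 big_fset /= big_mkcond. Qed.

Lemma big_fsetM (T T' : choiceType) (A : {fset T}) (B : {fset T'})
    (E : T * T' -> nat) :
  (\sum_(z <- (A `*` B)%fset) E z = \sum_(x <- A) \sum_(y <- B) E (x, y))%N.
Proof. by rewrite big_imfset2 //= => -[x y] [x' y'] _ _ /= [-> ->]. Qed.

Lemma Posz_sum (I : Type) (r : seq I) (P : pred I) (E : I -> nat) :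
  (\sum_(i <- r | P i) E i)%N%:Z = \sum_(i <- r | P i) (E i)%:Z.
Proof. exact: (big_morph Posz PoszD). Qed.

Section Count.
Variables (F : finFieldType) (k : nat).
Implicit Types (f g : {mpoly F[k]}) (x y h : normpoly F k) (d t m n : 'X_{1..k}).

Lemma PkE m n :
  (Pk F m n = \sum_(x <- normpolys F m) \sum_(y <- normpolys F n)
     `[< mpcoprime (repr x) (repr y) >])%N.
Proof. by rewrite /Pk card_fset_filter big_fsetM. Qed.

Lemma sum_multiples m d h : h \in normpolys F d -> (d <= m)%MM ->
  (\sum_(x <- normpolys F m) has_divisor (repr x) h = Nk F (m - d)%MM)%N.
Proof. by move=> hd dm; rewrite -card_fset_filter (card_multiples _ hd) dm. Qed.

Lemma sum_common_multiples m n d (E : normpoly F k -> int) :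
    (d <= m)%MM -> (d <= n)%MM ->
  \sum_(x <- normpolys F m) \sum_(y <- normpolys F n) \sum_(h <- normpolys F d)
    (if has_divisor (repr x) h && has_divisor (repr y) h then E h else 0) =
  (Nk F (m - d)%MM)%:Z * (Nk F (n - d)%MM)%:Z * \sum_(h <- normpolys F d) E h.
Proof.
move=> dm dn.
under eq_bigr do rewrite exchange_big; rewrite exchange_big mulr_sumr /= !big_seq.
apply: eq_bigr => h hd; rewrite -(sum_multiples hd dm) -(sum_multiples hd dn).
rewrite !Posz_sum mulr_suml mulr_suml.
apply: eq_bigr => x _; rewrite mulr_sumr mulr_suml; apply: eq_bigr => y _.
by do 2!case: has_divisor; rewrite ?(mul0r, mulr0, mul1r).
Qed.

Definition large_divisors t m n x y : int :=
  \sum_(d : 'X_{1..k < (mdeg m).+1} | [&& (d <= m)%MM, (d <= n)%MM & ~~ (d <= t)%MM])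
    \sum_(h <- normpolys F d)
      (if has_divisor (repr x) h && has_divisor (repr y) h then 1 else 0).

Definition small_classes t : nat :=
  \sum_(d : 'X_{1..k < (mdeg t).+1} | (d <= t)%MM) Nk F d.

Lemma truncated_moebius_error t m n x y :
    x \in normpolys F m -> y \in normpolys F n ->
  `| `[< mpcoprime (repr x) (repr y) >]%:Z -
     \sum_(d : 'X_{1..k < (mdeg t).+1} | (d <= t)%MM) \sum_(h <- normpolys F d)
     (if has_divisor (repr x) h && has_divisor (repr y) h then mu h else 0) | <=
  (small_classes t).+1%:Z * large_divisors t m n x y.
Proof.
rewrite !mem_normpolys_repr => /andP[x0 /eqP Dx] /andP[y0 /eqP Dy].
set bad := large_divisors _ _ _ _ _.
have bad0 : 0 <= bad by apply: sumr_ge0 => d _; apply: sumr_ge0 => h _; case: ifP.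
have [/eqP bad_eq0|bad_n0] := boolP (bad == 0).
  rewrite sum_mu_common_divisors // ?subrr ?normr0 ?bad_eq0 ?mulr0 // => h hx hy.
  apply: contraT => Dh; have h0 := divides_neq0 hx x0.
  have Dle f : f != 0 -> divides (repr h) f -> (Deg (repr h) <= Deg f)%MM.
    move=> f0 [e def_f]; rewrite def_f DegM ?lem_addl //.
    by move: f0; rewrite def_f mulf_eq0 => /norP[].
  have dm := Dle _ x0 hx; have dn := Dle _ y0 hy; rewrite Dx in dm; rewrite Dy in dn.
  have dP : (mdeg (Deg (repr h)) < (mdeg m).+1)%N by rewrite ltnS mdeg_le.
  have hN : h \in normpolys F (BMultinom dP) by rewrite mem_normpolys_repr h0 /=.
  suff : 1 <= bad by rewrite bad_eq0.
  rewrite /bad /large_divisors (bigD1 (BMultinom dP)) /= ?dm ?dn ?Dh //.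
  rewrite (big_fsetD1 h) //= /has_divisor !asboolT //= -[leLHS]addr0 -addrA lerD2l.
  apply: addr_ge0; apply: sumr_ge0 => ? _; first by case: ifP.
  by apply: sumr_ge0 => ? _; case: ifP.
apply: (@le_trans _ _ (small_classes t).+1%:Z); last first.
  by rewrite -[leLHS]mulr1 ler_wpM2l // -gtz0_ge1 lt_neqAle eq_sym bad_n0.
apply: le_trans (ler_normB _ _) _; rewrite -[(small_classes t).+1]add1n PoszD; apply: lerD.
  by case: asboolP.
apply: le_trans (ler_norm_sum _ _ _) _; rewrite /small_classes Posz_sum.
apply: ler_sum => d _; apply: le_trans (ler_norm_sum _ _ _) _.
rewrite /Nk card_fset_sum1 Posz_sum; apply: ler_sum => h _.
by case: ifP => _; rewrite ?normr0 ?norm_mu.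
Qed.

Lemma sum_large_divisors_le t m n :
    (forall i : 'I_k, (2 * t i + 1 < maxn (m i) (n i))%N) ->
  \sum_(x <- normpolys F m) \sum_(y <- normpolys F n) large_divisors t m n x y <=
  (2 ^ k * #|F| ^ (error_exponent t m n + (2 * mdeg t + 3)))%N%:Z.
Proof.
move=> big_mn; rewrite /large_divisors.
under eq_bigr do rewrite exchange_big; rewrite exchange_big /=.
have le_exp (d : 'X_{1..k < (mdeg m).+1}) :
    [&& (d <= m)%MM, (d <= n)%MM & ~~ (d <= t)%MM] ->
  (\prod_(i < k) (d i).+1 + \prod_(i < k) ((m - d)%MM i).+1 +
    \prod_(i < k) ((n - d)%MM i).+1 + mdeg d <= error_exponent t m n + (2 * mdeg t + 3))%N.
  case/and3P=> dm dn; rewrite negb_forall => /existsP[j]; rewrite -ltnNge => tdj.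
  exact: exponent_le dm dn tdj (big_mn j).
apply: le_trans (_ : _ <= _%:Z) _; last first.
  rewrite lez_nat; apply: sum_exp_le le_exp; exact: card_finNzRing_gt1.
rewrite Posz_sum; apply: ler_sum => d /and3P[dm dn _].
rewrite sum_common_multiples //.
have -> : \sum_(h <- normpolys F d) 1 = (Nk F d)%:Z.
  by rewrite /Nk card_fset_sum1 Posz_sum.
rewrite -!PoszM lez_nat -addnA [X in (_ ^ X)%N]addnC !expnD.
by rewrite !leq_mul ?Nk_le.
Qed.

End Count.

Theorem theorem5p6 (F : finFieldType) (k : nat) (t : 'X_{1..k}) :
  (2 <= k)%N ->
  exists C : nat, forall m n : 'X_{1..k},
    (t <= m)%MM -> (t <= n)%MM ->
    (forall i : 'I_k, (2 * t i + 1 < maxn (m i) (n i))%N) ->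
    (`| (Pk F m n)%:Z
        - \sum_(d : 'X_{1..k < (mdeg t).+1} | (d <= t)%MM)
            (Nk F (m - d)%MM)%:Z * (Nk F (n - d)%MM)%:Z * Ak F d |
     <= C%:Z * (#|F|%:Z) ^+ error_exponent t m n)%R.
Proof.
move=> _; exists ((small_classes F t).+1 * (2 ^ k * #|F| ^ (2 * mdeg t + 3)))%N.
move=> m n tm tn big_mn.
under eq_bigr => d dt.
  rewrite /Ak -(sum_common_multiples _ (lepm_trans dt tm) (lepm_trans dt tn)); over.
set c := (small_classes F t).+1.
apply: (@le_trans _ _ (\sum_(x <- normpolys F m) \sum_(y <- normpolys F n)
    c%:Z * large_divisors t m n x y)); last first.
  under eq_bigr do rewrite -mulr_sumr; rewrite -mulr_sumr.
  apply: le_trans (ler_wpM2l _ (sum_large_divisors_le F big_mn)) _ => //.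
  rewrite -!natz -natrX -!natrM ler_nat expnD.
  by rewrite [(#|F| ^ error_exponent t m n * _)%N]mulnC !mulnA.
rewrite PkE Posz_sum exchange_big /= -sumrB big_seq [leRHS]big_seq.
apply: le_trans (ler_norm_sum _ _ _) _; apply: ler_sum => x xm.
rewrite Posz_sum exchange_big /= -sumrB big_seq [leRHS]big_seq.
apply: le_trans (ler_norm_sum _ _ _) _; apply: ler_sum => y yn.
exact: truncated_moebius_error.
Qed.
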